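(* Let $G_n$ be a graph with vertices $v_1,\dots,v_n$ and adjacency matrix $\Gamma$, and let $\Lambda=[I_n\,|\,\Gamma]$ be the $n\times 2n$ matrix over $\mathbb{Z}/2\mathbb{Z}$. Then the diagonal distance of $G_n$ satisfies $$\Delta(G_n)=\min\left\{\sum_{i=1}^n \chi(k_i)>0 \;\middle|\; k\in(\mathbb{Z}/2\mathbb{Z})^{2n},\ \Lambda k=0 \pmod 2\right\}.$$
   Context: $G_n=(V,E)$ is an undirected graph with vertex set $V=\{v_1,\dots,v_n\}$; its adjacency matrix $\Gamma$ is the $n\times n$ matrix with $\Gamma_{ij}=1$ if $v_i,v_j$ are joined by an edge and $\Gamma_{ij}=0$ otherwise. A labelling of $G_n$ is an element $L=(L_1,\dots,L_n)\in(\mathbb{Z}/2\mathbb{Z})^n$ ($L_i$ is the label of $v_i$). For each $i$ define maps $(\mathbb{Z}/2\mathbb{Z})^n\to(\mathbb{Z}/2\mathbb{Z})^n$: $Z_i$ replaces $L_i$ by $L_i+1 \bmod 2$ and leaves other entries unchanged; $X_i$ replaces each $L_j$ by $L_j+\Gamma_{ij}\bmod 2$ for all $1\le j\le n$. Let $\langle Z_i,X_i\rangle$ be the group of maps generated by $Z_i$ and $X_i$ under composition, and $I$ the identity map of $(\mathbb{Z}/2\mathbb{Z})^n$. For $O_i\in\langle Z_i,X_i\rangle$ set $\eta(O_i)=1$ if $O_i\neq I$ and $\eta(O_i)=0$ if $O_i=I$. The diagonal distance is $$\Delta(G_n)=\min\left\{\sum_{i=1}^n\eta(O_i)>0 \;\middle|\;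 \prod_{i=1}^n O_i=I,\ O_i\in\langle Z_i,X_i\rangle,\ 1\le i\le n\right\},$$ where $\prod$ denotes composition. For $k=(k_1,\dots,k_{2n})$ and $1\le i\le n$, $\chi(k_i)=1$ if $k_i\ne0$ or $k_{i+n}\ne0$, and $\chi(k_i)=0$ if $k_i=k_{i+n}=0$. $I_n$ is the $n\times n$ identity matrix.
   Formalization: The formal theorem assumes n ≥ 1 and that every vertex has a neighbour other than itself (no isolated vertices); otherwise the right-hand minimum is 1 while Δ is at least 2 or undefined, so the claim fails. *)

(* Defs.v *)
From HB Require Import structures.
From mathcomp Require Import all_boot all_algebra all_fingroup.

Set Implicit Arguments.
Unset Strict Implicit.
Unset Printing Implicit Defensive.

Import GRing.Theory.
Local Open Scope ring_scope.

(* Vertices are 0, ..., n-1. Loops are not excluded; simple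
   graphs are the case where [adj G] is irreflexive. *)
Record ugraph (n : nat) := UGraph {
  adj : rel 'I_n;
  adj_sym : symmetric adj
}.

(* In a simple graph this says that there is no isolated vertex. If it fails at
   v_i, then X_i is I or Z_i, so a nonzero pair (k_i, k_(i+n)) can represent
   O_i = I and the two weights differ. *)
Definition has_proper_neighbours n (G : ugraph n) :=
  forall i : 'I_n, exists2 j : 'I_n, j != i & adj G i j.

Definition adjacency n (G : ugraph n) : 'M['F_2]_n :=
  \matrix_(i, j) (adj G i j)%:R.

Notation labelling n := 'rV['F_2]_n.

Definition Zmap n (i : 'I_n) (L : labelling n) : labelling n :=
  \row_j (if j == i then L 0 j + 1 else L 0 j).

Definition Xmap n (G : ugraph n) (i : 'I_n) (L : labelling n) : labelling n :=
  \row_j (L 0 j + adjacency G i j).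

Lemma Zmap_inj n (i : 'I_n) : injective (Zmap i).
Proof.
move=> L M /rowP eqLM; apply/rowP=> j; move: (eqLM j); rewrite !mxE.
by case: eqP => // _ /addIr.
Qed.

Lemma Xmap_inj n (G : ugraph n) (i : 'I_n) : injective (Xmap G i).
Proof.
move=> L M /rowP eqLM; apply/rowP=> j; move: (eqLM j); rewrite !mxE.
by move/addIr.
Qed.

Definition Zop n (i : 'I_n) : {perm labelling n} := perm (@Zmap_inj n i).

Definition Xop n (G : ugraph n) (i : 'I_n) : {perm labelling n} :=
  perm (@Xmap_inj n G i).

Definition local_group n (G : ugraph n) (i : 'I_n) :
  {group {perm labelling n}} := <<[set Zop i; Xop G i]>>%G.

Definition eta n (s : {perm labelling n}) : nat := (s != 1%g).

(* In {perm _}, s * t is composition with s applied first; the order of the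
   product is immaterial since all Z_i and X_i are translations. *)
Definition diagonal_weight n (G : ugraph n) (m : nat) : Prop :=
  exists O : 'I_n -> {perm labelling n},
    [/\ forall i, O i \in local_group G i,
        (\prod_(i < n) O i)%g = 1%g,
        m = (\sum_(i < n) eta (O i))%N
      & (0 < m)%N].

Definition is_min (S : nat -> Prop) (d : nat) : Prop :=
  S d /\ forall m : nat, S m -> (d <= m)%N.

(* d is the diagonal distance of G; a relation because the minimum need not
   exist, e.g. for a graph with one vertex and no edge. *)
Definition is_diagonal_distance n (G : ugraph n) (d : nat) : Prop :=
  is_min (diagonal_weight G) d.

Definition Lambda n (G : ugraph n) : 'M['F_2]_(n, n + n) :=
  row_mx 1%:M (adjacency G).

Definition chi n (k : 'cV['F_2]_(n + n)) (i : 'I_n) : nat :=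
  (k (lshift n i) 0 != 0) || (k (rshift n i) 0 != 0).

Definition kernel_weight n (G : ugraph n) (m : nat) : Prop :=
  exists k : 'cV['F_2]_(n + n),
    [/\ Lambda G *m k = 0, m = (\sum_(i < n) chi k i)%N & (0 < m)%N].

(* Main.v *)
(** Every [Z_i] and [X_i] is a translation of the space of labellings, so the
    elements of [<Z_i, X_i>] are the translations by [a e_i + b Gamma_i], and
    composing such translations over all [i] gives the translation by
    [a + Gamma b = Lambda (a, b)]. A neighbour of [v_i] other than [v_i] makes
    [e_i] and [Gamma_i] linearly independent, so the translation is the identity
    only for [a = b = 0] and the two weights agree. The vector
    [(Gamma e_0, e_0)] shows that the minimum exists. *)

Require Import Defs.
From mathcomp Require Import all_boot all_algebra all_fingroup.

Set Implicit Arguments.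
Unset Strict Implicit.
Unset Printing Implicit Defensive.

Import GRing.Theory.
Local Open Scope ring_scope.

Definition translation (V : finZmodType) (v : V) : {perm V} := perm (addIr v).

Lemma translation0 (V : finZmodType) : translation (0 : V) = 1%g.
Proof. by apply/permP=> L; rewrite permE perm1 addr0. Qed.

Lemma translationD (V : finZmodType) :
  {morph @translation V : u v / u + v >-> (u * v)%g}.
Proof. by move=> u v; apply/permP=> L; rewrite permM !permE addrA. Qed.

Lemma translationMn (V : finZmodType) (v : V) (m : nat) :
  translation (v *+ m) = (translation v ^+ m)%g.
Proof.
elim: m => [|m IHm]; first exact: translation0.
by rewrite mulrS translationD IHm expgS.
Qed.

Lemma translation_eq1 (V : finZmodType) (v : V) :
  (translation v == 1%g) = (v == 0).
Proof.
apply/eqP/eqP => [/permP/(_ 0)|->]; last exact: translation0.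
by rewrite permE perm1 add0r.
Qed.

Section DiagonalDistance.

Variables (n : nat) (G : ugraph n).

Definition local_shift (i : 'I_n) (a b : 'F_2) : 'rV['F_2]_n :=
  a *: delta_mx 0 i + b *: row i (adjacency G).

Lemma Zop_translation (i : 'I_n) : Zop i = translation (delta_mx 0 i).
Proof.
apply/permP=> L; rewrite !permE; apply/rowP=> j; rewrite !mxE eqxx /=.
by case: eqP => _; rewrite ?addr0.
Qed.

Lemma Xop_translation (i : 'I_n) :
  Xop G i = translation (row i (adjacency G)).
Proof. by apply/permP=> L; rewrite !permE; apply/rowP=> j; rewrite !mxE. Qed.

Lemma local_shiftD (i : 'I_n) (a b c d : 'F_2) :
  local_shift i a b + local_shift i c d = local_shift i (a + c) (b + d).
Proof. by rewrite /local_shift !scalerDl addrACA. Qed.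

Lemma local_shift_in (i : 'I_n) (a b : 'F_2) :
  translation (local_shift i a b) \in local_group G i.
Proof.
(* Scalars of ['F_2] are casts of natural numbers, so the translation becomes a power of [Zop i]
   times a power of [Xop G i]. *)
rewrite translationD -[a]natr_Zp -[b]natr_Zp !scaler_nat !translationMn.
rewrite -Zop_translation -Xop_translation.
by rewrite groupM // groupX // mem_gen // !inE eqxx ?orbT.
Qed.

Lemma local_groupP (i : 'I_n) (s : {perm labelling n}) :
  reflect (exists ab, s = translation (local_shift i ab.1 ab.2))
          (s \in local_group G i).
Proof.
apply: (iffP idP) => [|[ab ->]]; last exact: local_shift_in.
pose S := [set translation (local_shift i ab.1 ab.2) | ab : 'F_2 * 'F_2].
(* In a finite group, containing 1 and closure under products suffice; inverses come for free. *)
have S_group : group_set S.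
  apply/group_setP; split.
    apply/imsetP; exists (0, 0) => //.
    by rewrite /local_shift !scale0r addr0 translation0.
  move=> _ _ /imsetP[x _ ->] /imsetP[y _ ->].
  apply/imsetP; exists (x.1 + y.1, x.2 + y.2) => //.
  by rewrite -translationD local_shiftD.
have sub_S : local_group G i \subset Group S_group.
  rewrite gen_subG; apply/subsetP=> t /set2P[]->; apply/imsetP.
    by exists (1, 0); rewrite // /local_shift scale1r scale0r addr0
      Zop_translation.
  by exists (0, 1); rewrite // /local_shift scale1r scale0r add0r
    Xop_translation.
by move/(subsetP sub_S)/imsetP=> [ab _ ->]; exists ab.
Qed.

Lemma local_shift_eq0 (hG : has_proper_neighbours G) (i : 'I_n) (a b : 'F_2) :
  (local_shift i a b == 0) = (a == 0) && (b == 0).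
Proof.
apply/eqP/andP=> [/rowP shift0|[/eqP-> /eqP->]]; last first.
  by rewrite /local_shift !scale0r addr0.
have [j ji Gij] := hG i.
(* The entry at [j] sees only [b], since [j != i]. It must be read before the entry at [i], where a
   loop would make [b] contribute as well. *)
have b0 : b = 0.
  by have := shift0 j; rewrite !mxE (negPf ji) Gij mulr0 mulr1 add0r.
by have := shift0 i; rewrite !mxE !eqxx b0 mul0r mulr1 addr0 => ->.
Qed.

Lemma eta_local_shift (hG : has_proper_neighbours G) (k : 'cV['F_2]_(n + n))
    (i : 'I_n) :
  eta (translation (local_shift i (k (lshift n i) 0) (k (rshift n i) 0)))
  = chi k i.
Proof. by rewrite /eta translation_eq1 local_shift_eq0 // negb_and. Qed.

(** Labellings are rows and [k] is a column, hence the transpose. The shifts combine rows of the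
    adjacency matrix while [Lambda G *m k] combines its columns; symmetry of the graph reconciles
    the two. *)
Lemma sum_local_shift (k : 'cV['F_2]_(n + n)) :
  \sum_(i < n) local_shift i (k (lshift n i) 0) (k (rshift n i) 0)
  = (Lambda G *m k)^T.
Proof.
rewrite -[k in RHS]vsubmxK mul_row_col mul1mx.
apply/rowP=> j; rewrite summxE !mxE.
under eq_bigr do rewrite !mxE eqxx /=.
rewrite big_split /=; congr (_ + _).
  by rewrite (bigD1 j) //= eqxx mulr1 big1 ?addr0 // => i /negPf;
    rewrite eq_sym => ->; rewrite mulr0.
by apply: eq_bigr => i _; rewrite !mxE adj_sym mulrC.
Qed.

(** Since [translation] is an injective morphism, a product of translations is trivial exactly when
    their vectors sum to 0. *)
Lemma prod_local_shift_eq1 (k : 'cV['F_2]_(n + n)) :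
  ((\prod_(i < n)
      translation (local_shift i (k (lshift n i) 0) (k (rshift n i) 0)))%g
   == 1%g) = (Lambda G *m k == 0).
Proof.
rewrite -(big_morph _ (@translationD _) (@translation0 _)) translation_eq1.
by rewrite sum_local_shift trmx_eq0.
Qed.

Lemma diagonal_weightE (hG : has_proper_neighbours G) (m : nat) :
  diagonal_weight G m <-> kernel_weight G m.
Proof.
split=> [[O [Oloc Oprod -> m_gt0]]|[k [/eqP Lk0 -> m_gt0]]].
  (* Choice over the finite vertex set selects a coefficient pair for every [O i]; these pairs are
     then stacked into [k]. *)
  have [ab defO] := fin_all_exists (fun i => local_groupP i _ (Oloc i)).
  pose k : 'cV['F_2]_(n + n) := col_mx (\col_i (ab i).1) (\col_i (ab i).2).
  have defOk i :
      O i = translation (local_shift i (k (lshift n i) 0) (k (rshift n i) 0)).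
    by rewrite defO col_mxEu col_mxEd !mxE.
  exists k; split=> //.
    apply/eqP; rewrite -prod_local_shift_eq1; apply/eqP.
    by rewrite -[RHS]Oprod; apply: eq_bigr => i _; rewrite defOk.
  by apply: eq_bigr => i _; rewrite defOk eta_local_shift.
exists (fun i =>
  translation (local_shift i (k (lshift n i) 0) (k (rshift n i) 0))).
split=> // [i||]; first exact: local_shift_in.
  by apply/eqP; rewrite prod_local_shift_eq1.
by apply: eq_bigr => i _; rewrite eta_local_shift.
Qed.

(** Boolean form of [kernel_weight], so that [ex_minnP] can extract a least weight. *)
Definition kernel_weightb (m : nat) : bool :=
  [exists k : 'cV['F_2]_(n + n),
     [&& Lambda G *m k == 0, m == (\sum_(i < n) chi k i)%N & (0 < m)%N]].

Lemma kernel_weightP (m : nat) : reflect (kernel_weight G m) (kernel_weightb m).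
Proof.
apply: (iffP existsP) => [[k /and3P[/eqP Lk /eqP km m_gt0]]|[k [Lk km m_gt0]]].
  by exists k.
by exists k; apply/and3P; split=> //; apply/eqP.
Qed.

Lemma kernel_weight_exists (i : 'I_n) : exists m, kernel_weight G m.
Proof.
pose k : 'cV['F_2]_(n + n) :=
  col_mx (adjacency G *m delta_mx i 0) (delta_mx i 0).
exists (\sum_(j < n) chi k j)%N, k; split=> //.
  (* Both blocks contribute the same column, and its double vanishes in characteristic 2. *)
  by rewrite mul_row_col mul1mx -mulr2n -scaler_nat pchar_Zp ?scale0r.
rewrite (bigD1 i) //= addn_gt0; apply/orP; left.
have ki : k (rshift n i) 0 = 1 by rewrite col_mxEd !mxE !eqxx.
by rewrite /chi ki oner_eq0 orbT.
Qed.

End DiagonalDistance.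

Theorem theorem1 (n : nat) (hn : (0 < n)%N) (G : ugraph n)
    (hG : has_proper_neighbours G) :
  exists d : nat, is_diagonal_distance G d /\ is_min (kernel_weight G) d.
Proof.
have ex_weight : exists m, kernel_weightb G m.
  (* Positivity of [n] supplies vertex 0. *)
  have [m mP] := kernel_weight_exists G (Ordinal hn).
  by exists m; apply/kernel_weightP.
case: (ex_minnP ex_weight) => d /kernel_weightP dP d_min.
have minP m : kernel_weight G m -> (d <= m)%N by move/kernel_weightP/d_min.
exists d; split; split=> //; first exact/diagonal_weightE.
by move=> m /(diagonal_weightE hG); apply: minP.
Qed.
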